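(* Let $N$ be a Cartan semigroup in a C*-algebra $A$ with stable expectation $E:A\twoheadrightarrow B:=C^*(N_+)$. Then the ultrafilter groupoid $G=G_N$ of $N$ is Hausdorff.
   Context: **Cartan semigroups.** For a subset $N$ of a C*-algebra $A$, $N_+:=\{n^*n:n\in N\}$ and $C^*(N)$ is the C*-subalgebra generated by $N$. An expectation is a contractive idempotent linear map $A\to A$. $N\subseteq A$ is a Cartan semigroup if: (1) $N$ is a norm-closed *-subsemigroup of $A$ (closed under products and adjoints) with dense linear span in $A$; (2) $B:=C^*(N_+)$ is commutative and contained in $N$; (3) there is an expectation $E$ from $A$ onto $B$ which is stable, i.e. $E(n)n^*\in B$ for all $n\in N$. **Domination.** For $m,s,n\in N$, $m<_sn$ means $sm,ms,sn,ns\in B$ and $nsm=m=msn$; and $m<n$ means $m<_sn$ for some $s\in N$. **Ultrafilters.** A filter is a subset $F\subseteq N$ such that for all $m,n\in N$: $m,n\in F$ if and only if there is $l\in F$ with $l<m$ and $l<n$. An ultrafilter is a maximal proper filter ($F\ne N$). $G=G_N$ is the set of ultrafilters, with the topology generated by the sets $\mathcal{U}_n=\{U\in G:n\in U\}$, $n\in N$. Writing $T^<=\{s\in N:\exists t\in T,\ t<s\}$, $G$ is a groupoid under the product $T\cdot U=(TU)^<$, defined if and only if $0\notin TU$, with inverse $U^{-1}=U^*=\{u^*:u\in U\}$. *)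

(* Defs.v *)
From HB Require Import structures.
From mathcomp Require Import all_boot all_order all_algebra.
From mathcomp Require Import complex.
From mathcomp Require Import boolp classical_sets functions reals topology normedtype.

Set Implicit Arguments.
Unset Strict Implicit.
Unset Printing Implicit Defensive.

Import Order.TTheory GRing.Theory Num.Theory.
Import numFieldNormedType.Exports.

Local Open Scope classical_set_scope.
Local Open Scope ring_scope.

Declare Scope cstar_scope.
Delimit Scope cstar_scope with cstar.

Reserved Notation "a ** b" (at level 40, left associativity).

(* C*-algebras need not be unital here, whereas every ring of MathComp has a
   unit; hence the product is a separate operation on a complex Banach space,
   not the ring product.  Norms take their (nonnegative real) values in R[i],
   on which 0 <= z and x <= y entail that z and y - x are real. *)
HB.mixin Record Banach_isCStarAlgebra (R : realType) (A : Type)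
    & CompleteNormedModule [the numFieldType of R[i]] A := {
  cmul : A -> A -> A;
  star : A -> A;
  cmulA : forall a b c : A, cmul a (cmul b c) = cmul (cmul a b) c;
  cmulDl : forall a b c : A, cmul (a + b) c = cmul a c + cmul b c;
  cmulDr : forall a b c : A, cmul a (b + c) = cmul a b + cmul a c;
  cmulZl : forall (k : R[i]) (a b : A), cmul (k *: a) b = k *: cmul a b;
  cmulZr : forall (k : R[i]) (a b : A), cmul a (k *: b) = k *: cmul a b;
  ler_norm_cmul : forall a b : A, `|cmul a b| <= `|a| * `|b|;
  starD : forall a b : A, star (a + b) = star a + star b;
  starZ : forall (k : R[i]) (a : A), star (k *: a) = k^* *: star a;
  starM : forall a b : A, star (cmul a b) = cmul (star b) (star a);
  starK : forall a : A, star (star a) = a;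
  cstar_identity : forall a : A, `|cmul (star a) a| = `|a| ^+ 2
}.

#[short(type="cstarAlgType")]
HB.structure Definition CStarAlgebra (R : realType) :=
  { A of Banach_isCStarAlgebra R A
       & CompleteNormedModule [the numFieldType of R[i]] A }.

Notation "a ** b" := (cmul a b) : cstar_scope.
Local Open Scope cstar_scope.

Section CStarSubsets.
Context {R : realType} {A : cstarAlgType R}.
Implicit Types S B : set A.

Definition cstar_subalgebra B :=
  [/\ B 0,
      forall a b, B a -> B b -> B (a + b),
      forall (k : R[i]) a, B a -> B (k *: a),
      (forall a b, B a -> B b -> B (a ** b)) /\ (forall a, B a -> B (star a))
    & closed B].

Definition cstar_generated S : set A := smallest cstar_subalgebra S.

Definition linear_span S : set A :=
  [set x | exists (n : nat) (k : 'I_n -> R[i]) (a : 'I_n -> A),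
     (forall i, S (a i)) /\ x = \sum_(i < n) k i *: a i].

Definition expectation (E : A -> A) :=
  [/\ linear E, forall a, E (E a) = E a & forall a, `|E a| <= `|a|].

Definition expectation_onto B (E : A -> A) := expectation E /\ range E = B.

End CStarSubsets.

Section CartanSemigroups.
Context {R : realType} {A : cstarAlgType R}.
Variable N : set A.

Definition sq_set : set A := [set star n ** n | n in N].

Definition cartan_diag : set A := cstar_generated sq_set.

Definition stable (E : A -> A) :=
  forall n, N n -> cartan_diag (E n ** star n).

Definition stable_expectation (E : A -> A) :=
  expectation_onto cartan_diag E /\ stable E.

Definition cartan_semigroup :=
  [/\ [/\ closed N,
          forall m n, N m -> N n -> N (m ** n),
          forall n, N n -> N (star n)
        & closure (linear_span N) = setT],
      (forall a b, cartan_diag a -> cartan_diag b -> a ** b = b ** a) /\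
        cartan_diag `<=` N
    & exists E, stable_expectation E].

Definition dominated_by (m s n : A) :=
  [/\ cartan_diag (s ** m), cartan_diag (m ** s),
      cartan_diag (s ** n), cartan_diag (n ** s)
    & n ** s ** m = m /\ m = m ** s ** n].

Definition dominated (m n : A) := exists2 s, N s & dominated_by m s n.

Definition dom_filter (F : set A) :=
  F `<=` N /\
  forall m n, N m -> N n ->
    (F m /\ F n <-> exists l, [/\ F l, dominated l m & dominated l n]).

Definition proper_dom_filter (F : set A) := dom_filter F /\ F <> N.

Definition ultrafilter (U : set A) :=
  proper_dom_filter U /\
  forall F, proper_dom_filter F -> U `<=` F -> F = U.

(* The product and inverse of the groupoid are not recorded: this type carries
   only the set of ultrafilters and its topology. *)
Definition ultrafilter_groupoid : Type := {U : set A | ultrafilter U}.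

HB.instance Definition _ := gen_eqMixin ultrafilter_groupoid.
HB.instance Definition _ := gen_choiceMixin ultrafilter_groupoid.

(* Topology generated by the sets U_n = {U | n \in U} for n in N. *)
HB.instance Definition _ :=
  @isSubBaseTopological.Build ultrafilter_groupoid A N
    (fun n => [set U : ultrafilter_groupoid | sval U n]).

End CartanSemigroups.

(* Main.v *)
Require Import Defs.
From mathcomp Require Import all_boot all_order all_algebra.
From mathcomp Require Import boolp classical_sets reals topology normedtype.
From mathcomp Require Import complex sequences.

(** Write B for the diagonal C*(N_+). The idea is that two ultrafilters U, V
    which cannot be separated by basic open sets are contained in one proper
    filter, so that U = V by maximality.

    For u, v in N put g = E(u^* v) and w(u,v) = u g g^*. In the groupoid
    picture u and v are functions supported on open bisections, E restricts
    functions to the unit space, and w(u,v) is u cut down to the set where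
    u and v share an arrow. Two properties of w say that it behaves as a meet
    for domination:
    - if u < n or v < n, then w(u,v) < n (common_part_dominatedl and
      common_part_dominatedr);
    - if l < u and l < v, then l < w(u,v) (dominated_common_part).
    Hence the upward closure F of all w(u,v) with u in U and v in V is a filter
    which contains U and V. It is proper as soon as every u in U and v in V
    have a nonzero common lower bound, and such a lower bound exists whenever
    u and v lie in a common ultrafilter.

    Everything about domination is computed inside the commutative algebra B,
    thanks to the description of m < n as m = n a with n^* n invertible on the
    support of a (dominatedP). It rests on n B n^* being contained in B
    (diag_conj), a polarization argument.

    The expectation enters through one analytic fact: if b and h b lie in B,
    then h b = E(h) b (expectation_cmul). With stability it gives
    u^* v g^* = g g^*, so w(u,v) = u u^* v g^* is a piece of v as well as of u.
    This replaces the bimodule property of E and is proved as follows. For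
    k = h - E(h) one has E(k) = 0, so |p| <= |k + p| for every p in B. A
    Cayley transform 1 - z of a small multiple of b b^* is unitary, and
    p = - T k z in B leads to T |k z|^2 <= |k|^2 for all T >= 1. Hence k z = 0,
    and then k b = 0. *)

Set Implicit Arguments.
Unset Strict Implicit.
Unset Printing Implicit Defensive.

Import Order.TTheory GRing.Theory Num.Theory.
Import numFieldNormedType.Exports.

Local Open Scope classical_set_scope.
Local Open Scope ring_scope.
Local Open Scope cstar_scope.

(** * Arithmetic, norm and continuity in a C*-algebra *)

Section CStarArithmetic.
Context {R : realType} {A : cstarAlgType R}.
Implicit Types a b c : A.

Lemma cmul0l a : 0 ** a = 0.
Proof. by apply: (addrI (0 ** a)); rewrite -cmulDl !addr0. Qed.

Lemma cmul0r a : a ** 0 = 0.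
Proof. by apply: (addrI (a ** 0)); rewrite -cmulDr !addr0. Qed.

Lemma cmulNl a b : (- a) ** b = - (a ** b).
Proof. by apply: (addrI (a ** b)); rewrite -cmulDl !subrr cmul0l. Qed.

Lemma cmulNr a b : a ** (- b) = - (a ** b).
Proof. by apply: (addrI (a ** b)); rewrite -cmulDr !subrr cmul0r. Qed.

Lemma cmulBl a b c : (a - b) ** c = a ** c - b ** c.
Proof. by rewrite cmulDl cmulNl. Qed.

Lemma cmulBr a b c : a ** (b - c) = a ** b - a ** c.
Proof. by rewrite cmulDr cmulNr. Qed.

Lemma star0 : star 0 = 0 :> A.
Proof. by apply: (addrI (star 0)); rewrite -starD !addr0. Qed.

Lemma starN a : star (- a) = - star a.
Proof. by apply: (addrI (star a)); rewrite -starD !subrr star0. Qed.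

Lemma starB a b : star (a - b) = star a - star b.
Proof. by rewrite starD starN. Qed.

Lemma norm_star a : `|star a| = `|a|.
Proof.
have le b : `|b| <= `|star b|.
  have [->|b0] := eqVneq b 0; first by rewrite star0.
  rewrite -(ler_pM2r (x := `|b|)) ?normr_gt0 // -expr2 -cstar_identity.
  exact: ler_norm_cmul.
by apply/le_anti/andP; split; [rewrite -[in leRHS](starK a)|].
Qed.

Lemma norm_mul_star a : `|a ** star a| = `|a| ^+ 2.
Proof. by rewrite -(norm_star a) -cstar_identity starK. Qed.

Lemma star_mul_eq0 a : star a ** a = 0 -> a = 0.
Proof.
move=> a0; apply/eqP; rewrite -normr_eq0 -sqrf_eq0 -cstar_identity a0.
by rewrite normr0.
Qed.

Lemma mul_star_eq0 a : a ** star a = 0 -> a = 0.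
Proof.
by move=> a0; rewrite -(starK a) (@star_mul_eq0 (star a)) ?starK ?star0.
Qed.

Lemma continuous_cmull a : continuous (cmul a).
Proof.
move=> x; apply/cvgrPdist_lt => e e0.
have a1 : 0 < `|a| + 1 by rewrite ltr_wpDl.
have : \forall y \near x, `|x - y| < e / (`|a| + 1).
  by apply: (@cvgr_dist_lt _ _ _ (nbhs x) _ id x) => //; rewrite divr_gt0.
apply: filterS => y; rewrite -cmulBr ltr_pdivlMr // => lt_xy.
apply: le_lt_trans (ler_norm_cmul _ _) (le_lt_trans _ lt_xy).
by rewrite mulrC ler_wpM2l // lerDl.
Qed.

Lemma continuous_cmulr b : continuous (fun a => a ** b).
Proof.
move=> x; apply/cvgrPdist_lt => e e0.
have a1 : 0 < `|b| + 1 by rewrite ltr_wpDl.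
have : \forall y \near x, `|x - y| < e / (`|b| + 1).
  by apply: (@cvgr_dist_lt _ _ _ (nbhs x) _ id x) => //; rewrite divr_gt0.
apply: filterS => y; rewrite -cmulBl ltr_pdivlMr // => lt_xy.
apply: le_lt_trans (ler_norm_cmul _ _) (le_lt_trans _ lt_xy).
by rewrite ler_wpM2l // lerDl.
Qed.

End CStarArithmetic.

(** * Contractive projections onto commutative subalgebras *)

Section CommutativeSubalgebra.
Context {R : realType} {A : cstarAlgType R} (B : set A).
Context (hB : cstar_subalgebra B).
Context (commB : forall a b, B a -> B b -> a ** b = b ** a).

Lemma subalgD a b : B a -> B b -> B (a + b).
Proof. by case: hB => _ + _ _ _; apply. Qed.

Lemma subalgZ (k : R[i]) a : B a -> B (k *: a).
Proof. by case: hB => _ _ + _ _; apply. Qed.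

Lemma subalgM a b : B a -> B b -> B (a ** b).
Proof. by case: hB => _ _ _ [+ _] _; apply. Qed.

Lemma subalg_star a : B a -> B (star a).
Proof. by case: hB => _ _ _ [_ +] _; apply. Qed.

Lemma subalgB a b : B a -> B b -> B (a - b).
Proof. by move=> Ba Bb; rewrite -scaleN1r; apply/subalgD/subalgZ. Qed.

Lemma exp2N_lt (e : R[i]) : 0 < e -> exists n : nat, 2^-1 ^+ n < e.
Proof.
move=> e_gt0; have Re_gt0 : 0 < complex.Re e.
  by move: e_gt0; rewrite ltcE => /andP[].
have [n lt_n] : exists n : nat, 2^-1 ^+ n < complex.Re e.
  exists (Num.bound (complex.Re e)^-1).
  rewrite exprVn invf_plt ?posrE ?exprn_gt0 //.
  apply: lt_trans (archi_boundP _) _; first by rewrite invr_ge0 ltW.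
  by rewrite -natrX ltr_nat ltn_expl.
exists n; rewrite -(RRe_real (gtr0_real e_gt0)).
have -> : (2^-1 ^+ n : R[i]) = (2^-1 ^+ n)%:C%C.
  by rewrite rmorphXn /= fmorphV rmorph_nat.
by rewrite ltcR.
Qed.

(** The fixed point q = f (1 + i f)^-1 exists in B because q |-> f - i f q
    contracts distances by 1/2 and B is closed in a complete space. *)
Lemma resolvent_exists (f : A) : B f -> `|f| <= 2^-1 ->
  exists2 q, B q & q = f - 'i *: (f ** q).
Proof.
move=> Bf f_le; pose g x := f - 'i *: (f ** x).
pose u n := iter n g 0.
have Bu n : B (u n).
  elim: n => [|n IH]; first by case: hB.
  by apply/subalgB/subalgZ/subalgM.
have norm_i_cmul x : `|'i *: (f ** x)| <= 2^-1 * `|x|.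
  rewrite normrZ normCi mul1r.
  by apply: le_trans (ler_norm_cmul _ _) _; rewrite ler_wpM2r.
have half_ge0 : 0 <= 2^-1 :> R[i] by rewrite invr_ge0.
have u_le n : `|u n| <= 1.
  elim: n => [|n IH]; first by rewrite /u /= normr0.
  apply: le_trans (ler_normB _ _) _; rewrite [leRHS](splitr 1) div1r lerD //.
  by apply: le_trans (norm_i_cmul _) _; rewrite ler_piMr.
have u_dist n k : `|u (n + k)%N - u n| <= 2^-1 ^+ n.
  elim: n => [|n IH]; first by rewrite add0n subr0 expr0.
  rewrite addSn {1}/u !iterS -!/(u _) /g opprB addrC addrA subrK.
  rewrite -scalerBr -cmulBr exprS.
  by apply: le_trans (norm_i_cmul _) _; rewrite ler_wpM2l // distrC.
have cvg_u : cvg (u @ \oo).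
  apply/cauchy_cvgP; apply/cauchy_exP => e /exp2N_lt[n lt_e]; exists (u n).
  exists n => // m /= le_nm; rewrite -ball_normE /ball_ /=.
  by rewrite distrC (le_lt_trans _ lt_e) // -(subnKC le_nm).
set l := lim (u @ \oo) in cvg_u; exists l.
  apply: (@closed_cvg _ _ _ _ u B _ _ l cvg_u); first by case: hB.
  exact: nearW.
have cvg_gu : u n.+1 @[n --> \oo] --> g l.
  apply: cvgB; first exact: cvg_cst.
  apply: cvgZr; apply: continuous_cvg cvg_u; exact: continuous_cmull.
apply: (@cvg_unique _ (@norm_hausdorff _ A)) cvg_gu.
by have := cvg_u; rewrite -(cvg_shiftS u).
Qed.

(** The relation between q and its adjoint says that 1 - z is unitary for
    z = 2 i q. Since |1 - T z|^2 = 1 + (T^2 - T) z z^*, comparing the norm of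
    k (1 - T z) with that of its image - T k z under E gives
    T |k z|^2 <= |k|^2, which fails for large T unless k z = 0. *)
Lemma expectation_kernel_unitary (E : A -> A) (k q : A) :
  linear E -> (forall a, `|E a| <= `|a|) -> (forall b, B b -> E b = b) ->
  E k = 0 -> B q -> q - star q = (-2 * 'i) *: (q ** star q) ->
  B (k ** q) -> k ** q = 0.
Proof.
move=> linE E_le E_id Ek0 Bq unit_q Bkq.
pose z := (2 * 'i) *: q; pose y := k ** z.
have By : B y by rewrite /y cmulZr; exact: subalgZ.
have unit_z : z + star z = z ** star z.
  rewrite /z starZ rmorphM /= conjCi conjC_nat mulrN scaleNr -scalerBr unit_q.
  rewrite cmulZl cmulNr cmulZr scalerN scalerA -scaleNr scalerA; congr (_ *: _).
  by rewrite !mulNr mulrN.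
suff: y = 0.
  have i2_neq0 : 2 * 'i != 0 :> R[i] by rewrite mulf_neq0 ?neq0Ci ?pnatr_eq0.
  by rewrite /y cmulZr => /eqP; rewrite scaler_eq0 (negPf i2_neq0) => /eqP.
apply/eqP/negP => /negP y_neq0.
have y2_gt0 : 0 < `|y| ^+ 2 by rewrite exprn_gt0 // normr_gt0.
(* This T makes T |y|^2 exceed |k|^2 by exactly |y|^2. *)
pose T := `|k| ^+ 2 / `|y| ^+ 2 + 1.
have T_ge1 : 1 <= T by rewrite lerDr divr_ge0 ?exprn_ge0 ?normr_ge0.
have T_ge0 : 0 <= T := le_trans ler01 T_ge1.
have T_real : T^* = T by apply/CrealP/ger0_real.
have expand : (k - T *: y) ** star (k - T *: y) =
    k ** star k + (T ^+ 2 - T) *: (y ** star y).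
  (* Unitarity lets k z z^* k^* absorb the terms of degree one in T. *)
  have cross : k ** star y + y ** star k = y ** star y.
    rewrite /y starM !cmulA -cmulDl -cmulA -cmulDr addrC unit_z.
    by rewrite !cmulA.
  rewrite starB starZ T_real !cmulBl !cmulBr !cmulZl !cmulZr.
  rewrite -!addrA; congr (_ + _); rewrite opprB scalerA -expr2.
  by rewrite addrCA -opprD -scalerDr cross scalerBl.
have le1 : T ^+ 2 * `|y| ^+ 2 <= `|k - T *: y| ^+ 2.
  rewrite -exprMn; have <- : `|E (k - T *: y)| = T * `|y|.
    rewrite addrC -scaleNr linE Ek0 addr0 E_id // normrZ normrN ger0_norm //.
  by rewrite ler_pXn2r ?nnegrE ?normr_ge0.
have le2 : `|k - T *: y| ^+ 2 <= `|k| ^+ 2 + (T ^+ 2 - T) * `|y| ^+ 2.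
  rewrite -norm_mul_star expand -!(norm_mul_star) -[leRHS]/(_ + _).
  apply: le_trans (ler_normD _ _) _; rewrite normrZ ger0_norm //.
  by rewrite expr2 -[X in _ - X]mulr1 -mulrBr mulr_ge0 // subr_ge0.
have := le_trans le1 le2.
rewrite mulrBl addrCA lerDl subr_ge0 {1}/T mulrDl mul1r divfK ?gt_eqF //.
by rewrite gerDl lt_geF.
Qed.

(** When E is known to be a B-bimodule map this is E (k b) = E k b. Here it
    is reduced to the unitary case: the Cayley transform
    1 - 2 i q = (1 - i f) (1 + i f)^-1 of a small multiple f of b b^* is
    unitary, k q lies in B with k b, and conversely k q = 0 forces k f = 0. *)
Lemma expectation_kernel_cmul (E : A -> A) (k b : A) :
  linear E -> (forall a, `|E a| <= `|a|) -> (forall b, B b -> E b = b) ->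
  E k = 0 -> B b -> B (k ** b) -> k ** b = 0.
Proof.
move=> linE E_le E_id Ek0 Bb Bkb.
pose M := 2 * (`|b ** star b| + 1); pose f := M^-1 *: (b ** star b).
have M_gt0 : 0 < M by rewrite mulr_gt0 // ltr_wpDl.
have Bf : B f by apply/subalgZ/subalgM/subalg_star.
have f_sa : star f = f.
  rewrite /f starZ starM starK; congr (_ *: _).
  by apply/CrealP/ger0_real; rewrite invr_ge0 ltW.
have f_le : `|f| <= 2^-1.
  rewrite normrZ gtr0_norm ?invr_gt0 // mulrC ler_pdivrMr //.
  rewrite mulKf ?pnatr_eq0 //.
  by rewrite lerDl.
have fE : f = M^-1 *: (b ** star b) by [].
clearbody f; have [q Bq q_eq] := resolvent_exists Bf f_le.
have unit_q : q - star q = (-2 * 'i) *: (q ** star q).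
  have qs_eq : star q = f + 'i *: (star q ** f).
    by rewrite {1}q_eq starB starZ starM f_sa conjCi scaleNr opprK.
  have f_eq : f = q + 'i *: (f ** q) by rewrite {1}q_eq subrK.
  have fs_eq : f = star q - 'i *: (star q ** f) by rewrite {1}qs_eq addrK.
  have e1 : f ** q = star q ** q - 'i *: (star q ** f ** q).
    by rewrite {1}fs_eq cmulBl cmulZl.
  have e2 : star q ** f = star q ** q + 'i *: (star q ** f ** q).
    by rewrite {1}f_eq cmulDr cmulZr cmulA.
  rewrite {1}q_eq {1}qs_eq opprD addrACA subrr add0r -opprD -scalerDr.
  rewrite e2 e1 addrACA addNr addr0 -mulr2n -scaler_nat scalerA -scaleNr mulrC.
  by rewrite (commB (subalg_star Bq) Bq) mulNr.
have kfE : k ** f = M^-1 *: ((k ** b) ** star b) by rewrite fE cmulZr cmulA.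
have Bkf : B (k ** f) by rewrite kfE; apply/subalgZ/subalgM/subalg_star.
have kqE : k ** q = k ** f - 'i *: (k ** f ** q).
  by rewrite {1}q_eq cmulBr cmulZr cmulA.
have Bkq : B (k ** q) by rewrite kqE; apply/subalgB/subalgZ/subalgM.
have kq0 := expectation_kernel_unitary linE E_le E_id Ek0 Bq unit_q Bkq.
have kf0 : k ** f = 0.
  rewrite -[f](subrK ('i *: (f ** q))) -q_eq cmulDr kq0 add0r cmulZr.
  by rewrite (commB Bf Bq) cmulA kq0 cmul0l scaler0.
apply: mul_star_eq0; rewrite starM cmulA.
have -> : k ** b ** star b = M *: (k ** f).
  by rewrite kfE scalerA divff ?scale1r // gt_eqF.
by rewrite kf0 scaler0 cmul0l.
Qed.

End CommutativeSubalgebra.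

(** * The diagonal of a Cartan semigroup *)

Section Generated.
Context {R : realType} {A : cstarAlgType R}.

Lemma cstar_generated_subalgebra (S : set A) :
  cstar_subalgebra (cstar_generated S).
Proof.
split.
- by move=> B [[]].
- move=> a b ga gb B hB; case: (hB) => -[_ BD _ _ _] _.
  exact: BD (ga _ hB) (gb _ hB).
- by move=> k a ga B hB; case: (hB) => -[_ _ BZ _ _] _; exact: BZ (ga _ hB).
- split=> [a b ga gb|a ga] B hB; case: (hB) => -[_ _ _ [BM BV] _] _.
    exact: BM (ga _ hB) (gb _ hB).
  exact: BV (ga _ hB).
- by apply: closed_bigI => B [[]].
Qed.

(** When a and b lie in the diagonal, so do the four elements whose squares
    appear here, and conjugation by an element of N is easy on such squares. *)
Lemma polarization (a b : A) :
  a ** b = 4^-1 *: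
    ((star (star a + b) ** (star a + b) - star (star a - b) ** (star a - b)) -
     'i *: (star (star a + 'i *: b) ** (star a + 'i *: b)
            - star (star a - 'i *: b) ** (star a - 'i *: b))).
Proof.
have diff c d : star (c + d) ** (c + d) - star (c - d) ** (c - d) =
    2 *: (star c ** d + star d ** c).
  rewrite starB starD !(cmulDl, cmulDr, cmulBl, cmulBr).
  rewrite !opprD !opprK scalerDr !scaler_nat !mulr2n.
  rewrite addrACA; congr (_ + _).
    by rewrite addrACA subrr add0r.
  by rewrite addrACA subrr addr0.
rewrite !diff starK starZ conjCi cmulZr cmulZl.
set x := a ** b; set y := _ ** star a.
have -> : 'i *: (2 *: ('i *: x + - 'i *: y)) = 2 *: (y - x).
  rewrite !(scalerDr, scalerA) !mulrN mulrAC -expr2 sqrCi mulN1r opprK addrC.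
  by rewrite scaleNr scalerN.
rewrite -scalerBr opprB addrACA subrr addr0 -mulr2n -[x *+ 2]scaler_nat.
rewrite !scalerA.
have -> : 4^-1 * 2 * 2 = 1 :> R[i] by rewrite -mulrA -natrM mulVf ?pnatr_eq0.
by rewrite scale1r.
Qed.

End Generated.

Section CartanSemigroup.
Context {R : realType} {A : cstarAlgType R} (N : set A).
Context (hN : cartan_semigroup N).
Local Notation B := (cartan_diag N).

Lemma diag_subalgebra : cstar_subalgebra B.
Proof. exact: cstar_generated_subalgebra. Qed.

Let diagM a b : B a -> B b -> B (a ** b).
Proof. exact: subalgM diag_subalgebra _ _. Qed.

Let diagD a b : B a -> B b -> B (a + b).
Proof. exact: subalgD diag_subalgebra _ _. Qed.

Let diagB a b : B a -> B b -> B (a - b).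
Proof. exact: subalgB diag_subalgebra _ _. Qed.

Let diagZ (k : R[i]) a : B a -> B (k *: a).
Proof. exact: subalgZ diag_subalgebra _ _. Qed.

Let diagV a : B a -> B (star a).
Proof. exact: subalg_star diag_subalgebra _. Qed.

Lemma diag_comm a b : B a -> B b -> a ** b = b ** a.
Proof. by case: hN => _ [+ _] _; apply. Qed.

Lemma diag_sub a : B a -> N a.
Proof. by case: hN => _ [_ +] _; apply. Qed.

Lemma semigroupM m n : N m -> N n -> N (m ** n).
Proof. by case: hN => -[_ + _ _] _ _; apply. Qed.

Lemma semigroup_star n : N n -> N (star n).
Proof. by case: hN => -[_ _ + _] _ _; apply. Qed.

Lemma diag_sq n : N n -> B (star n ** n).
Proof. by move=> Nn; apply: sub_gen_smallest; exists n. Qed.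

Lemma diag_sqr n : N n -> B (n ** star n).
Proof. by move=> /semigroup_star/diag_sq; rewrite starK. Qed.

(** For b = c^* c with c in N the conjugate n b n^* is a square of an element of
    N. Polarization makes the set of all good b closed under products. *)
Lemma diag_conj n b : N n -> B b -> B (n ** b ** star n).
Proof.
pose T := [set c | B c /\ forall n, N n -> B (n ** c ** star n)].
have conj_sq m c : N m -> N c -> B (m ** (star c ** c) ** star m).
  move=> Nm Nc; have := diag_sqr (semigroupM Nm (semigroup_star Nc)).
  by rewrite starM starK !cmulA.
suff BT : B `<=` T by move=> Nn /BT[_]; apply.
have sub := diag_subalgebra.
have conjD m a c : B (m ** a ** star m) -> B (m ** c ** star m) ->
    B (m ** (a + c) ** star m).
  by rewrite cmulDr cmulDl; apply: diagD.
have conjZ m k a : B (m ** a ** star m) -> B (m ** (k *: a) ** star m).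
  by rewrite cmulZr cmulZl; apply: diagZ.
apply: smallest_sub; last first.
  by move=> _ [m Nm <-]; split=> [|n' Nn']; [exact: diag_sq|exact: conj_sq].
split.
- split=> [|m Nm]; rewrite ?cmul0r ?cmul0l; by case: sub.
- move=> a c [Ba Ta] [Bc Tc]; split=> [|m Nm]; first exact: diagD.
  by apply: (conjD); [apply: Ta|apply: Tc].
- move=> k a [Ba Ta]; split=> [|m Nm]; first exact: diagZ.
  by apply: (conjZ); apply: Ta.
- split=> [a c [Ba Ta] [Bc Tc]|a [Ba Ta]]; split=> [|m Nm]; first exact: diagM.
  + have sqB x : B x -> B (m ** (star x ** x) ** star m).
      by move=> /diag_sub; apply: conj_sq.
    have Bic : B ('i *: c) by exact: diagZ.
    have Bsa := diagV Ba.
    rewrite (polarization a c); apply: (conjZ); apply: (conjD).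
      by apply: (conjD); [|rewrite -scaleN1r; apply: (conjZ)]; apply: (sqB);
         [exact: diagD|exact: diagB].
    rewrite -scaleNr; apply: (conjZ).
    by apply: (conjD); [|rewrite -scaleN1r; apply: (conjZ)]; apply: (sqB);
       [exact: diagD|exact: diagB].
  + exact: diagV.
  + by have := diagV (Ta m Nm); rewrite !starM starK cmulA.
- have clB : closed B by case: sub.
  have -> : T = B `&` \bigcap_(m in N) ((fun c => m ** c ** star m) @^-1` B).
    by [].
  apply: closedI => //; apply: closed_bigI => m Nm.
  apply: preimage_closed => //.
  have cont : continuous (fun c => m ** c ** star m).
    move=> c; apply: (@continuous_comp _ _ _ (cmul m) (fun x => x ** star m)).
      exact: continuous_cmull.
    exact: continuous_cmulr.
  by move=> c _; exact: cont.
Qed.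

(** * Domination as factorization through the diagonal *)

Lemma diag_commA a b x : B a -> B b -> a ** (b ** x) = b ** (a ** x).
Proof. by move=> Ba Bb; rewrite cmulA (diag_comm Ba Bb) -cmulA. Qed.

Lemma diag_star_cancel c x :
  B c -> B x -> star x ** (c ** x) = 0 -> c ** x = 0.
Proof.
move=> Bc Bx e; apply: star_mul_eq0.
by rewrite starM -cmulA diag_commA ?e ?cmul0r //; apply: diagV.
Qed.

(** As d fixes m m^* in the commutative algebra B, so does its adjoint, and then
    the C*-identity gives the same for m. *)
Lemma diag_star_fix d m : B d -> B (m ** star m) -> d ** m = m ->
  star d ** m = m.
Proof.
move=> Bd Bmm dm; apply/eqP; rewrite -subr_eq0; apply/eqP/mul_star_eq0.
have e1 : m ** star m ** star d = m ** star m.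
  by rewrite -cmulA -starM dm.
have e2 : star d ** (m ** star m) = m ** star m.
  by rewrite diag_comm ?e1 //; apply: diagV.
rewrite starB starM starK cmulBl !cmulBr !cmulA -[_ ** m ** star m]cmulA e2.
by rewrite subrr.
Qed.

(** In one direction a = s m and r = s s^*: as n s acts on m as the identity,
    so does (n s)^*, hence n^* n s s^* s m = s (n s)^* m = s m. In the
    other direction s = r n^*, a local inverse of n where a lives. This form
    involves no unknown outside B, so domination becomes a computation with
    commuting elements. *)
Lemma dominatedP m n : N n ->
  dominated N m n <->
  exists a r, [/\ B a, B r, m = n ** a & star n ** n ** (r ** a) = a].
Proof.
move=> Nn; split=> [[s Ns [Bsm Bms Bsn Bns [nsm msn]]]|[a [r [Ba Br -> ra]]]].
  have Nsm : B (m ** star m).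
    rewrite -nsm starM !cmulA.
    have := diag_conj Nn (diagM Bsm (diagV Bsm)).
    by rewrite !starM !cmulA.
  have dm := diag_star_fix Bns Nsm nsm.
  exists (s ** m), (s ** star s); split=> //; first exact: diag_sqr.
    by rewrite cmulA.
  rewrite cmulA (diag_comm (diag_sq Nn) (diag_sqr Ns)).
  by rewrite -[in RHS]dm -[in RHS]nsm starM !cmulA.
exists (r ** star n); first exact: semigroupM (diag_sub Br) (semigroup_star Nn).
have Bsq := diag_sq Nn.
have rn : r ** star n ** n = star n ** n ** r by rewrite -cmulA diag_comm.
have na : n ** (r ** star n) ** (n ** a) = n ** a.
  by rewrite -cmulA [_ ** (n ** a)]cmulA rn -[_ ** a]cmulA ra.
split=> //.
- by rewrite cmulA rn -cmulA ra.
- by rewrite cmulA -[_ ** r]cmulA; exact: diag_conj Nn (diagM Ba Br).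
- by rewrite rn; apply: diagM.
- by rewrite cmulA; apply: diag_conj.
- split=> //; rewrite -cmulA rn -cmulA; congr (n ** _).
  by rewrite (diag_comm Ba (diagM Bsq Br)) -cmulA ra.
Qed.

Lemma dominated_mulr m n b : N n -> B b ->
  dominated N m n -> dominated N (m ** b) n.
Proof.
move=> Nn Bb /(dominatedP m Nn)[a [r [Ba Br -> ra]]].
apply/dominatedP => //; exists (a ** b), r; split=> //; first exact: diagM.
  by rewrite cmulA.
by rewrite [r ** _]cmulA cmulA ra.
Qed.

Lemma dominated_star m n : dominated N m n -> dominated N (star m) (star n).
Proof.
move=> [s Ns [Bsm Bms Bsn Bns [nsm msn]]]; exists (star s).
  exact: semigroup_star.
by split; rewrite -?starM; try exact: diagV; split; rewrite cmulA ?nsm -?msn.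
Qed.

Lemma dominated_mull m n b : N n -> B b ->
  dominated N m n -> dominated N (b ** m) n.
Proof.
move=> Nn Bb mn; rewrite -(starK (b ** m)) -(starK n) starM.
apply/dominated_star/dominated_mulr/dominated_star => //.
  exact: semigroup_star.
exact: diagV.
Qed.

Lemma dominated_trans l m n : N m -> N n ->
  dominated N l m -> dominated N m n -> dominated N l n.
Proof.
move=> Nm Nn /(dominatedP l Nm)[a [r [Ba Br -> _]]] mn.
exact: dominated_mulr.
Qed.

Lemma dominated_by0 m n : dominated N m n -> n = 0 -> m = 0.
Proof. by move=> [s _ [_ _ _ _ [<- _]]] ->; rewrite !cmul0l. Qed.

Lemma dominates0 n : dominated N 0 n.
Proof.
have B0 : B 0 by case: diag_subalgebra.
exists 0; first exact: diag_sub.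
by split; rewrite ?cmul0l ?cmul0r.
Qed.

(** * The stable expectation and the common part of two elements *)

Context (E : A -> A) (hE : stable_expectation N E).

Let BE a : B (E a).
Proof. by case: hE => -[_ <-] _; exists a. Qed.

Let E_id b : B b -> E b = b.
Proof. by case: hE => -[[_ EE _] <-] _ [a _ <-]. Qed.

Let linE : linear E.
Proof. by case: hE => -[[]]. Qed.

Let E_le a : `|E a| <= `|a|.
Proof. by case: hE => -[[]]. Qed.

(** This locality of E stands in for the bimodule property: on the part of the
    unit space where h itself is diagonal, E does not change h. *)
Lemma expectation_cmul h b : B b -> B (h ** b) -> h ** b = E h ** b.
Proof.
move=> Bb Bhb; apply/eqP; rewrite -subr_eq0 -cmulBl; apply/eqP.
apply: (expectation_kernel_cmul diag_subalgebra diag_comm linE E_le E_id) => //.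
  by rewrite addrC -scaleN1r linE E_id // scaleN1r addNr.
by rewrite cmulBl; apply: diagB => //; apply: diagM.
Qed.

(** Stability is what makes h E(h)^* diagonal, so that locality applies with
    b = E(h)^* : an arrow in the support of h whose source lies in the support of
    E(h) has to be a unit. *)
Lemma expectation_mul_star h : N h -> h ** star (E h) = E h ** star (E h).
Proof.
move=> Nh; apply: expectation_cmul; first exact: diagV.
have := diagV (hE.2 h Nh).
by rewrite starM starK.
Qed.

(** For bisections u and v, the function E(u^* v) is supported on the sources of
    the arrows that u and v share. It is multiplied by its adjoint to make the
    two-sided expression of common_partE available. *)
Definition common_part u v :=
  u ** (E (star u ** v) ** star (E (star u ** v))).

Lemma common_partE u v : N u -> N v ->
  common_part u v = u ** star u ** (v ** star (E (star u ** v))).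
Proof.
move=> Nu Nv; rewrite /common_part -expectation_mul_star ?cmulA //.
by apply: semigroupM => //; apply: semigroup_star.
Qed.

Lemma semigroup_common_part u v : N u -> N (common_part u v).
Proof.
by move=> Nu; exact: semigroupM Nu (diag_sub (diagM (BE _) (diagV (BE _)))).
Qed.

Lemma common_part_dominatedl u v n : N n ->
  dominated N u n -> dominated N (common_part u v) n.
Proof.
move=> Nn un; apply: dominated_mulr => //.
exact: diagM (BE _) (diagV (BE _)).
Qed.

Lemma common_part_dominatedr u v n : N u -> N v -> N n ->
  dominated N v n -> dominated N (common_part u v) n.
Proof.
move=> Nu Nv Nn vn; rewrite common_partE //.
apply: dominated_mull (diag_sqr Nu) _ => //.
exact: dominated_mulr (diagV (BE _)) _.
Qed.

(** Write l = u a = v c and h = u^* v, g = E(h), G = g g^*. On the support of l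
    the function h is diagonal, so g agrees with it and |g|^2 agrees with
    (u^* u) (v^* v). The latter is invertible there because l < u and l < v,
    and the inverse T = r s recovers l as u G (T a). *)
Lemma dominated_common_part l u v : N u -> N v ->
  dominated N l u -> dominated N l v -> dominated N l (common_part u v).
Proof.
move=> Nu Nv /(dominatedP l Nu)[a [r [Ba Br l_ua ra]]].
move=> /(dominatedP l Nv)[c [s [Bc Bs l_vc sc]]].
rewrite /common_part; set h := star u ** v; set g := E h.
have ua_vc : u ** a = v ** c by rewrite -l_ua.
have BP := diag_sq Nu; have BQ := diag_sq Nv.
set P := star u ** u in ra BP; set Q := star v ** v in sc BQ.
have Bg : B g := BE h; have Bg' := diagV Bg.
have hc : h ** c = P ** a by rewrite /h /P -!cmulA ua_vc.
have gc : g ** c = P ** a.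
  by rewrite -hc -expectation_cmul // hc; apply: diagM.
have ha : star h ** a = Q ** c by rewrite /h /Q starM starK -!cmulA ua_vc.
have PE : star u ** u = P by [].
clearbody g h P Q; set G := g ** star g; have BG : B G by exact: diagM.
have G_sa : star G = G by rewrite /G starM starK.
have GE : star g ** g = G by rewrite diag_comm.
clearbody G.
(* |g c|^2 = |h c|^2, and
   h^* h c = h^* (u^* u a) = (h^* a) (u^* u) = (v^* v c) (u^* u). *)
have Gc : G ** c = P ** (Q ** c).
  apply/eqP; rewrite -subr_eq0 cmulA -cmulBl; apply/eqP.
  apply: diag_star_cancel => //; first exact: diagB BG (diagM BP BQ).
  have -> : star c ** ((G - P ** Q) ** c) =
      star (g ** c) ** (g ** c) - star c ** (P ** Q ** c).
    by rewrite -GE starM cmulBl cmulBr !cmulA.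
  rewrite gc -hc starM -!cmulA hc (diag_comm BP Ba) [star h ** _]cmulA ha.
  by rewrite -cmulA (diag_comm Bc BP) (diag_commA _ BQ BP) subrr.
have a_gc : a = r ** (g ** c) by rewrite gc (diag_commA _ Br BP) ra.
have Ga : G ** a = P ** (Q ** a).
  rewrite a_gc (diag_commA _ BG Br) (diag_commA _ BG Bg) Gc.
  rewrite (diag_commA _ BQ Br) (diag_commA _ BP Br); congr (r ** _).
  by rewrite (diag_commA _ BQ Bg) (diag_commA _ BP Bg).
have sa : Q ** (s ** a) = a.
  rewrite a_gc (diag_commA _ Bs Br) (diag_commA _ BQ Br); congr (r ** _).
  by rewrite (diag_commA _ Bs Bg) (diag_commA _ BQ Bg) sc.
pose T := r ** s; have BT : B T by exact: diagM.
have GTa : G ** (T ** a) = a.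
  rewrite (diag_commA _ BG BT) Ga /T -cmulA.
  rewrite (diag_commA _ Bs BP) (diag_commA _ Bs BQ) sa.
  by rewrite (diag_commA _ Br BP) ra.
clearbody T; apply/dominatedP; first exact: semigroupM Nu (diag_sub BG).
exists (T ** a), (T ** (T ** r)); split.
- exact: diagM.
- by apply: diagM => //; apply: diagM.
- by rewrite -cmulA GTa.
- rewrite starM G_sa -!cmulA [star u ** _]cmulA PE.
  rewrite (diag_commA _ BP BG).
  rewrite (diag_commA _ Br BT) !(diag_commA _ BP BT) ra !(diag_commA _ BG BT).
  have TGa : T ** (G ** a) = a by rewrite (diag_commA _ BT BG).
  by rewrite (diag_commA _ BT BG) !TGa.
Qed.

Lemma common_part_mono u v u' v' : N u -> N v -> N u' -> N v' ->
  dominated N u' u -> dominated N v' v ->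
  dominated N (common_part u' v') (common_part u v).
Proof.
move=> Nu Nv Nu' Nv' u'u v'v; apply: dominated_common_part => //.
  exact: common_part_dominatedl.
exact: common_part_dominatedr.
Qed.

Lemma common_part_neq0 l u v : N u -> N v ->
  dominated N l u -> dominated N l v -> l != 0 -> common_part u v != 0.
Proof.
move=> Nu Nv lu lv; apply: contra_neq.
exact/dominated_by0/dominated_common_part.
Qed.

(** * The filter generated by common parts *)

Lemma filter_inf F m n : dom_filter N F -> F m -> F n ->
  exists l, [/\ F l, dominated N l m & dominated N l n].
Proof.
by move=> [FN Fiff] Fm Fn; apply/(Fiff m n (FN _ Fm) (FN _ Fn)).
Qed.

Definition common_filter (U V : set A) : set A :=
  [set n | N n /\ exists u v, [/\ U u, V v & dominated N (common_part u v) n]].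

Section CommonFilter.
Context (U V : set A) (filU : dom_filter N U) (filV : dom_filter N V).

(** Shrinking u and v shrinks the common part strictly, by monotonicity, so
    common parts of smaller pairs interpolate between the given elements. *)
Lemma common_filterP : dom_filter N (common_filter U V).
Proof.
have [UN _] := filU; have [VN _] := filV.
split=> [n []//|m n Nm Nn]; split; last first.
  move=> [l [[Nl [u [v [Uu Vv wl]]]] lm ln]].
  by split; split=> //; exists u, v; split=> //; apply: dominated_trans wl _.
move=> [[_ [u1 [v1 [Uu1 Vv1 wm]]]] [_ [u2 [v2 [Uu2 Vv2 wn]]]]].
have [u [Uu uu1 uu2]] := filter_inf filU Uu1 Uu2.
have [v [Vv vv1 vv2]] := filter_inf filV Vv1 Vv2.
have [u' [Uu' u'u _]] := filter_inf filU Uu Uu.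
have [v' [Vv' v'v _]] := filter_inf filV Vv Vv.
have Nw x y : U x -> N (common_part x y).
  by move=> /UN; exact: semigroup_common_part.
exists (common_part u v); split.
- split; first exact: Nw.
  exists u', v'; split=> //.
  by apply: common_part_mono => //; (exact: UN || exact: VN).
- apply: (dominated_trans _ _ _ wm) => //; first exact: Nw.
  by apply: common_part_mono => //; (exact: UN || exact: VN).
- apply: (dominated_trans _ _ _ wn) => //; first exact: Nw.
  by apply: common_part_mono => //; (exact: UN || exact: VN).
Qed.

Lemma sub_common_filterl v : V v -> U `<=` common_filter U V.
Proof.
move=> Vv n Un; have [UN _] := filU.
have [u [Uu un _]] := filter_inf filU Un Un.
split; [exact: UN|exists u, v; split=> //].
exact/common_part_dominatedl/un/UN.
Qed.

Lemma sub_common_filterr u : U u -> V `<=` common_filter U V.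
Proof.
move=> Uu n Vn; have [UN _] := filU; have [VN _] := filV.
have [v [Vv vn _]] := filter_inf filV Vn Vn.
split; [exact: VN|exists u, v; split=> //].
by apply: common_part_dominatedr => //; (exact: UN || exact: VN).
Qed.

End CommonFilter.

Lemma proper_filter_neq0 F n : proper_dom_filter N F -> F n -> n != 0.
Proof.
move=> [[FN Fiff] F_neq] Fn; apply/eqP => n0; apply: F_neq.
rewrite n0 in Fn.
apply/seteqP; split=> // m Nm; apply: (proj1 ((Fiff m m Nm Nm).2 _)).
by exists 0; split=> //; exact: dominates0.
Qed.

(** The hypothesis makes every common part nonzero, so the filter they
    generate is proper and equals both U and V by maximality. *)
Lemma ultrafilter_eq (U V : set A) : ultrafilter N U -> ultrafilter N V ->
  (forall u v, U u -> V v -> exists2 W, proper_dom_filter N W & W u /\ W v) ->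
  U = V.
Proof.
move=> [[filU pU] maxU] [[filV pV] maxV] meetUV.
(* The empty set may be an ultrafilter, with no common parts available; then
   maximality applies to the inclusion of the empty set. *)
have [[u Uu]|U0] := pselect (exists u, U u); last first.
  by apply/esym/maxU => // x Ux; case: U0; exists x.
have [[v Vv]|V0] := pselect (exists v, V v); last first.
  by apply/maxV => // x Vx; case: V0; exists x.
have [UN _] := filU; have [VN _] := filV.
suff pF : proper_dom_filter N (common_filter U V).
  rewrite -(maxU _ pF (sub_common_filterl filU Vv)).
  exact: maxV pF (sub_common_filterr filU filV Uu).
split=> [|FN]; first exact: common_filterP.
have : common_filter U V 0 by rewrite FN; apply/diag_sub; case: diag_subalgebra.
move=> [_ [x [y [Ux Vy /dominated_by0 /(_ erefl) w0]]]].
have [W pW [Wx Wy]] := meetUV x y Ux Vy.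
have [l [Wl lx ly]] := filter_inf pW.1 Wx Wy.
have := common_part_neq0 (UN _ Ux) (VN _ Vy) lx ly (proper_filter_neq0 pW Wl).
by rewrite w0 eqxx.
Qed.

Lemma nbhs_basic (U : ultrafilter_groupoid N) n : sval U n ->
  nbhs U [set W : ultrafilter_groupoid N | sval W n].
Proof.
move=> Un; have Nn : N n by case: (proj2_sig U) => -[[UN _] _] _; exact: UN.
apply: open_nbhs_nbhs; split=> //.
exists [set [set W : ultrafilter_groupoid N | sval W n]]; last first.
  by rewrite bigcup_set1.
move=> _ ->; exact: (finI_from1 (fun n => [set W | sval W n]) Nn).
Qed.

Lemma hausdorff_groupoid : hausdorff_space (ultrafilter_groupoid N).
Proof.
move=> [U ultU] [V ultV] clUV.
suff eqUV : U = V.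
  by case: _ / eqUV in ultV clUV *; congr exist; exact: Prop_irrelevance.
apply: ultrafilter_eq => // u v Uu Vv.
have [[W ultW] [/= Wu Wv]] :=
  clUV _ _ (@nbhs_basic (exist _ U ultU) u Uu)
    (@nbhs_basic (exist _ V ultV) v Vv).
by exists W; [case: ultW|].
Qed.

End CartanSemigroup.

Theorem corollary8p6 (R : realType) (A : cstarAlgType R) (N : set A)
    (E : A -> A) (hN : cartan_semigroup N) (hE : stable_expectation N E) :
  hausdorff_space (ultrafilter_groupoid N).
Proof. exact: (hausdorff_groupoid hN hE). Qed.
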